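(* Let $\ell\ge2$ and let $\mathcal R$ be a merging $\ell$-vertex rule, with associated random graph sequences $(G(m))_{m\ge0}=(G_n^{\mathcal R}(m))_{m\ge0}$ on $[n]$. Let $h_m(n)$ be any function with $h_m(n)=o(n)$, and let $0\le a<b$ be constants. Then the probability that there exist $m_1,m_2$ with $L_1(G(m_1))\le an$, $L_1(G(m_2))\ge bn$ and $m_2\le m_1+h_m(n)$ tends to $0$ as $n\to\infty$.
   Context: $\ell$-vertex rule: fix an integer $\ell\ge2$. For each $n$, let $(\underline v_1,\underline v_2,\dots)$ be an i.i.d. sequence, where each $\underline v_m=(v_{m,1},\dots,v_{m,\ell})$ consists of $\ell$ vertices of $[n]$ chosen independently and uniformly at random. There is a filtration $\mathcal F_0\subseteq\mathcal F_1\subseteq\cdots$ such that $\underline v_m$ is $\mathcal F_m$-measurable and independent of $\mathcal F_{m-1}$. An $\ell$-vertex rule is a random sequence of graphs $(G(m))_{m\ge0}$ on $[n]$ such that: (i) $G(0)$ is empty; (ii) for $m\ge1$, $G(m)=G(m-1)\cup E_m$ where $E_m$ is a (possibly empty) $\mathcal F_m$-measurable set of edges each joining two vertices of $\underline v_m$; (iii) if the $\ell$ vertices of $\underline v_m$ lie in $\ell$ distinct components of $G(m-1)$, then $E_m\ne\varnothing$. Merging: for every $\varepsilon>0$, $n$, $m\ge1$, whenever $C,C'$ are distinct components of $G(m-1)$ with $|C|,|C'|\ge\varepsilon n$, conditional on $\mathcal F_{m-1}$ the probability that $C$ and $C'$ lie in the same component of $G(m)$ is at least $\varepsilon^\ell$.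 $L_1(G)$ is the number of vertices in a largest component of $G$. *)

(* Defs.v *)
From HB Require Import structures.
From mathcomp Require Import all_boot all_order all_algebra.
From mathcomp Require Import all_classical all_reals all_analysis.

Set Implicit Arguments.
Unset Strict Implicit.
Unset Printing Implicit Defensive.

Import Order.TTheory GRing.Theory Num.Theory.
Local Open Scope classical_set_scope.
Local Open Scope ring_scope.

(* A graph on the vertex set [n] = 'I_n, given by its edge set
   (an edge is stored as an ordered pair; adjacency is symmetrized). *)
Definition graph (n : nat) := {set 'I_n * 'I_n}.

Definition adj n (g : graph n) : rel 'I_n :=
  fun x y => ((x, y) \in g) || ((y, x) \in g).

Definition comp n (g : graph n) (x : 'I_n) : {set 'I_n} :=
  [set y | connect (adj g) x y].

Definition L1 n (g : graph n) : nat := \max_(x : 'I_n) #|comp g x|.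

Definition is_filtration d (T : measurableType d) (F : nat -> set (set T)) :=
  forall m, [/\ sigma_algebra setT (F m), F m `<=` measurable & F m `<=` F m.+1].

(* v_m (m >= 1) is F_m-measurable, uniformly distributed on [n]^l, and
   independent of F_{m-1}: P(A /\ v_m = t) = P(A) / n^l for A in F_{m-1}.
   (This implies that (v_1, v_2, ...) is i.i.d. uniform.) *)
Definition uniform_indep_tuples (R : realType) d (T : measurableType d)
  (P : probability T R) (F : nat -> set (set T)) (l n : nat)
  (v : nat -> T -> {ffun 'I_l -> 'I_n}) :=
  forall m, (0 < m)%N ->
    (forall t, F m [set w | v m w = t]) /\
    (forall A t, F m.-1 A ->
       P (A `&` [set w | v m w = t]) = (P A * ((n ^ l)%:R^-1)%:E)%E).

Definition ell_vertex_rule d (T : measurableType d) (F : nat -> set (set T))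
  (l n : nat) (v : nat -> T -> {ffun 'I_l -> 'I_n})
  (E G : nat -> T -> graph n) :=
  (forall w, G 0%N w = finset.set0) /\
  forall m, (0 < m)%N ->
    [/\ (forall w, G m w = G m.-1 w :|: E m w),
        (forall S, F m [set w | E m w = S]),
        (forall w (e : 'I_n * 'I_n), e \in E m w ->
            [/\ exists i, e.1 = v m w i, exists j, e.2 = v m w j & e.1 != e.2])
      & (forall w, (forall i j : 'I_l, i != j ->
                     ~~ connect (adj (G m.-1 w)) (v m w i) (v m w j)) ->
                   E m w != finset.set0)].

(* Merging property, with the conditional probability given F_{m-1}
   written out via its defining property: on the (F_{m-1}-measurable)
   event B that x and y lie in distinct components of G(m-1), both of
   size >= eps n, P(x ~ y in G(m) | F_{m-1}) >= eps^l, i.e.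
   P(A /\ B /\ {x ~ y in G(m)}) >= eps^l P(A /\ B) for all A in F_{m-1}. *)
Definition merging (R : realType) d (T : measurableType d)
  (P : probability T R) (F : nat -> set (set T)) (l n : nat)
  (G : nat -> T -> graph n) :=
  forall (eps : R), 0 < eps -> forall m, (0 < m)%N -> forall x y : 'I_n,
  forall A, F m.-1 A ->
    let B := [set w | [/\ ~~ connect (adj (G m.-1 w)) x y,
                         eps * n%:R <= (#|comp (G m.-1 w) x|)%:R
                       & eps * n%:R <= (#|comp (G m.-1 w) y|)%:R]] in
    ((eps ^+ l)%:E * P (A `&` B) <=
       P (A `&` B `&` [set w | connect (adj (G m w)) x y]))%E.

(* Main.v *)
(** Suppose [L_1] jumps from [a N] to [b N] in [o(N)] steps, on [N] vertices.
    An [l]-vertex step touches at most [l] components, so just before the jump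
    nearly [b N] vertices lie in components of size at least [k], for every
    constant [k].  Let [sigma_k] be the first time at which [alpha N] vertices
    do, where [a < alpha < b].

    Growth: let [W] be the set of these vertices at time [sigma_k]; it meets at
    most [N / k] components.  As long as [L_1 <= a N], each step decreases the
    number of components meeting [W] with probability bounded below: either many
    vertices of [W] lie in small components, and [l] random ones are in distinct
    components, or two linear-sized components meet [W], and the merging property
    applies.  Hence the jump occurs before [sigma_k + C N / k], outside an event
    of exponentially small probability.

    Scales: since the number of vertices in components of size at least [k] still
    increases by about [(b - alpha) N] during the [C N / k] steps after [sigma_k],
    linearly many vertices are at time [sigma_k] in components of size between
    [k / B] and [k].  A component of size at most [k] is untouched during [C N / k]
    steps with probability bounded below, so for each scale [k = B^(j+1)] the
    expected number of vertices in components of this scale just before the jump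
    is at least [kappa N P(jump)].  With [J] disjoint scales,
    [J kappa P(jump) <= 1 + o(1)], and [J] is arbitrary. *)

Require Import Defs.
From HB Require Import structures.
From mathcomp Require Import all_boot all_order all_algebra.
From mathcomp Require Import all_classical all_reals all_analysis.
From mathcomp Require Import ring lra zify.

Set Implicit Arguments.
Unset Strict Implicit.
Unset Printing Implicit Defensive.

Import Order.TTheory GRing.Theory Num.Theory.
Import numFieldNormedType.Exports.
Local Notation comp := Defs.comp.

Local Open Scope ring_scope.

(** * Components of a finite graph, and how many of them meet a given set *)

Section Graphs.
Import mathcomp.boot.fintype mathcomp.boot.finset.
Variable n : nat.
Implicit Types (g : graph n) (x y : 'I_n) (W U : {set 'I_n}).

Lemma connect_adjC g : connect_sym (adj g).
Proof. by apply: sym_connect_sym => x y; rewrite /adj orbC. Qed.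

Lemma mem_comp g x : x \in comp g x.
Proof. by rewrite inE connect0. Qed.

Lemma eq_comp g x y : connect (adj g) x y -> comp g x = comp g y.
Proof.
by move=> xy; apply/setP => z; rewrite !inE (same_connect (@connect_adjC g) xy).
Qed.

Lemma connect_sub_graph {g g'} :
  g \subset g' -> subrel (connect (adj g)) (connect (adj g')).
Proof.
move=> sgg'; apply: connect_sub => x y xy; apply: connect1.
by case/orP: xy => /(subsetP sgg') gxy; rewrite /adj gxy ?orbT.
Qed.

Lemma comp_sub {g g'} x : g \subset g' -> comp g x \subset comp g' x.
Proof. by move=> s; apply/subsetP=> y; rewrite !inE; exact: connect_sub_graph. Qed.

Lemma card_comp_le_L1 g x : (#|comp g x| <= L1 g)%N.
Proof. exact: (bigop.leq_bigmax x). Qed.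

Lemma L1_mono {g g'} : g \subset g' -> (L1 g <= L1 g')%N.
Proof.
move=> s; apply/bigop.bigmax_leqP => x _.
by apply: leq_trans (card_comp_le_L1 g' x); exact: subset_leq_card (comp_sub x s).
Qed.

Definition in_comp_ge k g : {set 'I_n} := [set x | (k <= #|comp g x|)%N].

(** Vertices of one component have the same image, so this counts the components meeting [W]. It is
    the potential of the growth argument. *)
Definition ncomps W g := #|[set comp g x | x in W]|.

(* Maps each component of a subgraph of [g'] to the component of [g'] that
   contains it. *)
Let absorb g' (S : {set 'I_n}) : {set 'I_n} :=
  [set y | [exists z in S, connect (adj g') z y]].

Let absorb_comp g g' x : g \subset g' -> absorb g' (comp g x) = comp g' x.
Proof.
move=> s; apply/setP => y; rewrite !inE; apply/existsP/idP => [[z]|xy].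
  rewrite inE => /andP[/(connect_sub_graph s)]; exact: connect_trans.
by exists x; rewrite mem_comp.
Qed.

Let absorb_imset g g' W : g \subset g' ->
  [set comp g' x | x in W] = [set absorb g' S | S in [set comp g x | x in W]].
Proof.
by move=> s; rewrite -imset_comp; apply: eq_imset => x /=; rewrite absorb_comp.
Qed.

Lemma ncomps_mono W {g g'} : g \subset g' -> (ncomps W g' <= ncomps W g)%N.
Proof. by move=> s; rewrite /ncomps (absorb_imset _ s) leq_imset_card. Qed.

(** [absorb] maps the old components meeting [W] onto the new ones. If their numbers were equal it
    would be injective, yet it identifies the components of [x] and [y]. *)
Lemma ncomps_drop W g g' x y : g \subset g' -> x \in W -> y \in W ->
  ~~ connect (adj g) x y -> connect (adj g') x y ->
  (ncomps W g' < ncomps W g)%N.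
Proof.
move=> s xW yW nxy xy; rewrite ltn_neqAle ncomps_mono // andbT.
rewrite /ncomps (absorb_imset _ s); apply: contra nxy => /imset_injP inj.
have /setP/(_ y) : comp g x = comp g y.
  by apply: inj; rewrite ?imset_f // !absorb_comp // (eq_comp xy).
by rewrite mem_comp inE.
Qed.

Lemma trivIset_comps W g : finset.trivIset [set comp g x | x in W].
Proof.
apply/finset.trivIsetP => _ _ /imsetP[x _ ->] /imsetP[y _ ->]; apply: contraR.
case/pred0Pn => z /andP[/=]; rewrite !inE => xz yz.
by apply/eqP/eq_comp; apply: connect_trans xz _; rewrite connect_adjC.
Qed.

(** The components involved are disjoint and have at least [k] vertices each. This bounds the
    initial value of the potential. *)
Lemma ncomps_in_comp_ge k g : (ncomps (in_comp_ge k g) g * k <= n)%N.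
Proof.
have -> : (ncomps (in_comp_ge k g) g * k
    = \sum_(S in [set comp g x | x in in_comp_ge k g]) k)%N by rewrite sum_nat_const.
have /eqP cov := trivIset_comps (in_comp_ge k g) g.
have : (\sum_(S in [set comp g x | x in in_comp_ge k g]) #|S| <= n)%N.
  by rewrite cov -[leqRHS]card_ord; exact: max_card.
apply: leq_trans; apply: leq_sum => _ /imsetP[x xk ->].
by rewrite inE in xk.
Qed.

(** A new edge has both ends in [U], so a component of [g] disjoint from [U] remains closed under
    adjacency in [g']. *)
Lemma comp_untouched g g' U x : g \subset g' ->
  (forall e, e \in g' -> e \in g \/ e.1 \in U /\ e.2 \in U) ->
  [disjoint comp g x & U] -> comp g' x = comp g x.
Proof.
move=> s gg' dis; apply/eqP; rewrite eq_sym eqEsubset comp_sub //=.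
apply/subsetP => y; rewrite inE => xy.
have cl : fingraph.closed (adj g') (mem (comp g x)).
  apply: intro_closed; first exact: connect_adjC.
  move=> u v uv; rewrite !inE => xu.
  have uU : u \notin U.
    by apply/negP => uU; have := disjointFl dis uU; rewrite inE xu.
  apply: connect_trans xu _; apply: connect1.
  case/orP: uv => /gg' [e|[/= e1 e2]]; rewrite /adj.
  - by rewrite e.
  - by rewrite e1 in uU.
  - by rewrite e orbT.
  - by rewrite e2 in uU.
by rewrite -(closed_connect cl xy) mem_comp.
Qed.

(** Each vertex of [U] accounts for the vertices of its own component if that component is small,
    and for none otherwise. *)
Lemma card_touched_small g U s :
  (#|[set x | (#|comp g x| < s)%N && ~~ [disjoint comp g x & U]]| <= s * #|U|)%N.
Proof.
pose f u := if (#|comp g u| < s)%N then comp g u else finset.set0.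
have sub : [set x | (#|comp g x| < s)%N && ~~ [disjoint comp g x & U]]
    \subset \bigcup_(u in U) f u.
  apply/subsetP => x; rewrite inE => /andP[xs /pred0Pn[u /andP[/=]]].
  rewrite inE => xu uU; apply/bigcupP; exists u => //.
  by rewrite /f -(eq_comp xu) xs mem_comp.
apply: leq_trans (subset_leq_card sub) _.
apply: (@leq_trans (\sum_(u in U) #|f u|)).
  by apply: (big_ind2 (fun (A : {set 'I_n}) m => #|A| <= m)%N) => [|A m B p Am Bp|//];
    rewrite ?cards0 // (leq_trans (leq_card_setU A B)) ?leq_add.
rewrite mulnC -sum_nat_const; apply: leq_sum => u _.
by rewrite /f; case: ifP => [/ltnW//|]; rewrite cards0.
Qed.

(* Choosing the coordinates one at a time, each one has to avoid fewer than [l]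
   components of size at most [s]. *)
Section Spread.
Variables (R : realFieldType) (g : graph n) (W : {set 'I_n}) (s : R) (l : nat).
Hypotheses (s0 : 0 <= s) (Ws : forall x, x \in W -> (#|comp g x|)%:R <= s)
  (Wl : (2 * l)%:R * s <= (#|W|)%:R).

Let far x y := ~~ connect (adj g) x y.
Let spread r := [set t : r.-tuple 'I_n | all (mem W) t && pairwise far t].

Let spread_step r (t : r.-tuple 'I_n) : (r < l)%N -> t \in spread r ->
  s <= (#|[set x in W | all (far x) t]|)%:R.
Proof.
rewrite inE => rl /andP[/allP tW _].
have sub : W \subset [set x in W | all (far x) t] :|: \bigcup_(i < r) comp g (tnth t i).
  apply/subsetP => x xW; rewrite !inE xW /=.
  have [//|/= /allPn[y /tnthP[i ->]]] := boolP (all (far x) t).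
  rewrite /far negbK => xy; apply/bigcupP; exists i => //.
  by rewrite inE connect_adjC.
have := subset_leq_card sub => /leq_trans/(_ (leq_card_setU _ _)).
rewrite -(ler_nat R) natrD => le1.
have le2 : (#|\bigcup_(i < r) comp g (tnth t i)|)%:R <= r%:R * s.
  apply: (@le_trans _ _ (\sum_(i < r) (#|comp g (tnth t i)|)%:R)).
    rewrite -natr_sum ler_nat.
    by apply: (big_ind2 (fun (A : {set 'I_n}) m => #|A| <= m)%N) => [|A m B p Am Bp|//];
      rewrite ?cards0 // (leq_trans (leq_card_setU A B)) ?leq_add.
  rewrite -[r in leRHS]card_ord mulr_natl -sumr_const; apply: ler_sum => i _.
  by apply: Ws; apply: tW; exact: mem_tnth.
(* The components of the [r < l] chosen vertices cover at most [(l - 1) * s] of the at least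
   [2 * l * s] vertices of [W]. *)
have rl1 : r%:R + 1 <= l%:R :> R by rewrite natr1 ler_nat.
have le3 : (r%:R + 1) * s <= l%:R * s by apply: ler_wpM2r.
have : 0 <= l%:R * s by rewrite mulr_ge0.
move: Wl; rewrite natrM; lra.
Qed.

Let card_spread r : (r <= l)%N -> s ^+ r <= (#|spread r|)%:R.
Proof.
elim: r => [_|r IHr rl].
  rewrite expr0 ler1n card_gt0; apply/set0Pn; exists [tuple].
  by rewrite inE.
pose f (p : 'I_n * r.-tuple 'I_n) : r.+1.-tuple 'I_n := [tuple of p.1 :: p.2].
pose Q := [set p : 'I_n * r.-tuple 'I_n | (p.2 \in spread r) &&
             (p.1 \in [set x in W | all (far x) p.2])].
have f_inj : injective f.
  by move=> [x t] [x1 t1] /(congr1 val) [-> e]; congr pair; exact: val_inj.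
have fQ : f @: Q \subset spread r.+1.
  apply/subsetP => y /imsetP[[x t]]; rewrite !inE /= => /andP[/andP[tW tf] /andP[xW xt]] ->.
  by rewrite /f /= xW xt tW tf.
have := subset_leq_card fQ; rewrite card_imset // -(ler_nat R); apply: le_trans.
have -> : #|Q| = (\sum_(t in spread r) #|[set x in W | all (far x) t]|)%N.
  rewrite -sum1_card; under [RHS]eq_bigr do rewrite -sum1_card.
  rewrite (exchange_big_dep predT) //= pair_big_dep /=.
  by apply: eq_bigl => -[x t]; rewrite inE.
rewrite natr_sum exprSr; apply: (@le_trans _ _ (\sum_(t in spread r) s)).
  by rewrite sumr_const -mulr_natl; apply: ler_wpM2r => //; exact: IHr (ltnW rl).
by apply: ler_sum => t; exact: spread_step.
Qed.

Lemma card_spread_ffun : s ^+ l <= (#|[set t : {ffun 'I_l -> 'I_n} |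
    [forall i, t i \in W] && [forall i, forall j, (i != j) ==>
      ~~ connect (adj g) (t i) (t j)]]|)%:R.
Proof.
apply: le_trans (card_spread (leqnn l)) _; rewrite ler_nat.
pose f (t : l.-tuple 'I_n) := [ffun i => tnth t i].
have f_inj : injective f.
  by move=> t t' /ffunP e; apply: eq_from_tnth => i; have := e i; rewrite !ffunE.
rewrite -(card_imset _ f_inj); apply/subset_leq_card/subsetP.
move=> y /imsetP[t tS ->]; rewrite in_set; move: tS; rewrite in_set => /andP[/allP tW tf].
apply/andP; split.
  by apply/forallP => i; rewrite ffunE; apply: tW; exact: mem_tnth.
apply/forallP => i; apply/forallP => j; apply/implyP => ij; rewrite !ffunE.
(* [pairwise] compares only increasing pairs of indices; symmetry of connectivity gives the
   others. *)
wlog lij : i j ij / (i < j)%N.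
  move=> H; case: (ltngtP i j) => [|ji|/val_inj e]; first exact: H.
    by rewrite connect_adjC H // eq_sym.
  by rewrite e eqxx in ij.
have x0 : 'I_n := tnth t i; rewrite !(tnth_nth x0).
by move/(pairwiseP x0)/(_ i j): tf; rewrite !inE !size_tuple; apply.
Qed.

End Spread.

End Graphs.

(** * Deterministic bounds along a single trajectory *)

Section Trajectory.
Import mathcomp.boot.fintype mathcomp.boot.finset.
Variables (l n : nat) (v : nat -> {ffun 'I_l -> 'I_n}) (G : nat -> graph n).

Definition values (t : {ffun 'I_l -> 'I_n}) : {set 'I_n} := [set t i | i in 'I_l].

(** The vertices offered in steps [m + 1] to [m + t]; those of step [m] have already been used in
    [G m]. *)
Definition touched m t : {set 'I_n} := \bigcup_(i < t) values (v (m + i).+1).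

Definition grows_on_values := forall m, G m \subset G m.+1 /\
  forall e, e \in G m.+1 -> e \in G m \/
    e.1 \in values (v m.+1) /\ e.2 \in values (v m.+1).

Hypothesis hG : grows_on_values.

Lemma graph_mono m m' : (m <= m')%N -> G m \subset G m'.
Proof.
move/subnK <-; elim: (m' - m)%N => // t IHt.
by rewrite addSn (subset_trans IHt) //; case: (hG (t + m)).
Qed.

Lemma touchedS m t : touched m t.+1 = touched m t :|: values (v (m + t).+1).
Proof. by rewrite /touched big_ord_recr. Qed.

Lemma touched_sub m t t' : (t <= t')%N -> touched m t \subset touched m t'.
Proof.
move/subnK <-; elim: (t' - t)%N => // r IHr.
by rewrite addSn touchedS (subset_trans IHr) // subsetUl.
Qed.

Lemma card_touched m t : (#|touched m t| <= t * l)%N.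
Proof.
elim: t => [|t IHt]; first by rewrite /touched big_ord0 cards0.
rewrite touchedS (leq_trans (leq_card_setU _ _)) // mulSn addnC leq_add //.
by rewrite (leq_trans (leq_imset_card _ _)) // card_ord.
Qed.

Lemma comp_untouched_steps m t x : [disjoint comp (G m) x & touched m t] ->
  comp (G (m + t)) x = comp (G m) x.
Proof.
elim: t => [|t IHt]; first by rewrite addn0.
rewrite touchedS -setI_eq0 setIUr setU_eq0 !setI_eq0 => /andP[d1 d2].
have e : comp (G (m + t)) x = comp (G m) x by rewrite IHt.
have [s1 s2] := hG (m + t).
by rewrite addnS -e (comp_untouched s1 s2) // e.
Qed.

(** A vertex that was in a component of size below [s] at time [m] and ends in one of size at least
    [k] had its old component touched. At most [t * l] vertices are touched, and each accounts for
    at most [s] such vertices. *)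
Lemma card_in_comp_ge_steps s k m t : (s <= k)%N ->
  (#|in_comp_ge k (G (m + t))| <= #|in_comp_ge s (G m)| + s * (t * l))%N.
Proof.
move=> sk; set U := touched m t.
set A := [set x | (#|comp (G m) x| < s)%N && ~~ [disjoint comp (G m) x & U]].
have sub : in_comp_ge k (G (m + t)) \subset in_comp_ge s (G m) :|: A.
  apply/subsetP => x; rewrite !in_set => kx; case: leqP => //= xs.
  by apply: contraTN kx => /comp_untouched_steps ->; rewrite -ltnNge (leq_trans xs).
apply: leq_trans (subset_leq_card sub) _.
apply: leq_trans (leq_card_setU _ _) _; rewrite leq_add2l.
by apply: leq_trans (card_touched_small _ _ _) _; rewrite leq_mul2l card_touched orbT.
Qed.

End Trajectory.

Local Open Scope classical_set_scope.

(** * Events of a sigma-algebra given as a family of sets *)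

Section SigmaAlgebra.
Variables (T : Type) (S : set (set T)).
Hypothesis hS : sigma_algebra setT S.

Lemma sigma_algebra0 : S set0. Proof. by case: hS. Qed.

Lemma sigma_algebraC A : S A -> S (~` A).
Proof. by case: hS => _ h _ /h; rewrite setTD. Qed.

Lemma sigma_algebraU A B : S A -> S B -> S (A `|` B).
Proof.
case: hS => S0 _ h SA SB; rewrite -bigcup2E; apply: h => -[|[|i]] //=.
Qed.

Lemma sigma_algebraI A B : S A -> S B -> S (A `&` B).
Proof.
move=> SA SB; rewrite -(setCK (A `&` B)) setCI.
by apply: sigma_algebraC; apply: sigma_algebraU; exact: sigma_algebraC.
Qed.

(** The event is a countable union of fibers, indexed by codes of [I]; codes of no value, or of a
    value outside [p], contribute the empty set. *)
Lemma sigma_algebra_fiber (I : countType) (X : T -> I) (p : pred I) :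
  (forall t, S [set w | X w = t]) -> S [set w | p (X w)].
Proof.
move=> SX; case: hS => S0 _ h.
have -> : [set w | p (X w)] = \bigcup_k
    (if unpickle k is Some t then if p t then [set w | X w = t] else set0 else set0).
  apply/seteqP; split => w /=.
    by move=> pw; exists (pickle (X w)); rewrite ?pickleK ?pw.
  by case=> k _; case: (unpickle k) => // t; case: ifP => // pt /= ->.
by apply: h => k; case: (unpickle k) => // t; case: ifP.
Qed.

End SigmaAlgebra.

(** * Real-valued probabilities, finite unions and total probability *)

Section RealProbability.
Variables (R : realType) (d : measure_display) (T : measurableType d)
  (P : probability T R).
Implicit Types A B : set T.

Definition pr A : R := fine (P A).

Lemma prE A : measurable A -> P A = (pr A)%:E.
Proof. by move=> mA; rewrite /pr fineK // fin_num_measure. Qed.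

Lemma pr_ge0 A : 0 <= pr A.
Proof. by rewrite fine_ge0. Qed.

Lemma pr_le1 A : measurable A -> pr A <= 1.
Proof. by move=> mA; rewrite -lee_fin -prE // probability_le1. Qed.

Lemma pr_le A B : measurable A -> measurable B -> A `<=` B -> pr A <= pr B.
Proof. by move=> mA mB AB; rewrite -lee_fin -!prE // le_measure ?inE. Qed.

Lemma pr0 : pr set0 = 0.
Proof. by rewrite /pr measure0. Qed.

Lemma pr_split A B : measurable A -> measurable B ->
  pr A = pr (A `&` B) + pr (A `\` B).
Proof.
move=> mA mB; apply: EFin_inj; rewrite EFinD -!prE; last 3 first.
- exact: measurableD.
- exact: measurableI.
- by [].
rewrite -measureU; first by rewrite setUIDK.
- exact: measurableI.
- exact: measurableD.
- by apply/seteqP; split => // w [[_ ?] [_ ?]].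
Qed.

Lemma pr_disj M (A : nat -> set T) : (forall i, (i < M)%N -> measurable (A i)) ->
  (forall i j w, (i < M)%N -> (j < M)%N -> A i w -> A j w -> i = j) ->
  measurable [set w | exists2 i, (i < M)%N & A i w] /\
  pr [set w | exists2 i, (i < M)%N & A i w] = \sum_(i < M) pr (A i).
Proof.
elim: M => [|M IHM] mA dA.
  rewrite big_ord0 (_ : [set _ | _] = set0) ?pr0 //.
  by apply/seteqP; split => // w [].
have [m1 e1] := IHM (fun i iM => mA i (leqW iM))
  (fun i j w iM jM => dA i j w (leqW iM) (leqW jM)).
have e2 : [set w | exists2 i, (i < M.+1)%N & A i w] =
    [set w | exists2 i, (i < M)%N & A i w] `|` A M.
  apply/seteqP; split => w /=.
    by case=> i; rewrite ltnS leq_eqVlt => /orP[/eqP->|iM] Ai; [right|left; exists i].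
  by case=> [[i iM Ai]|AM]; [exists i => //; exact: leqW|exists M].
have mM := mA M (ltnSn M).
split; first by rewrite e2; exact: measurableU.
rewrite big_ord_recr /= -e1 e2 [LHS](pr_split (B := A M)) //; last exact: measurableU.
rewrite [LHS]addrC; congr (pr _ + pr _); apply/seteqP; split => w /=.
- by move=> [[//|AM] /(_ AM)].
- case=> i iM Ai; split; first by left; exists i.
  by move=> AM; have := dA i M w (leqW iM) (ltnSn M) Ai AM; lia.
- by case.
- by move=> AM; split => //; right.
Qed.

Lemma pr_union M (A : nat -> set T) : (forall i, (i < M)%N -> measurable (A i)) ->
  measurable [set w | exists2 i, (i < M)%N & A i w] /\
  pr [set w | exists2 i, (i < M)%N & A i w] <= \sum_(i < M) pr (A i).
Proof.
(* Removing the earlier sets makes the family disjoint without changing its union. *)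
move=> mA; pose D i := A i `\` [set w | exists2 j, (j < i)%N & A j w].
have mU k : (k <= M)%N -> measurable [set w | exists2 j, (j < k)%N & A j w].
  elim: k => [_|k IHk kM].
    by rewrite (_ : [set _ | _] = set0) //; apply/seteqP; split => // w [].
  rewrite (_ : [set _ | _] = [set w | exists2 i, (i < k)%N & A i w] `|` A k).
    by apply: measurableU; [exact: IHk (ltnW kM)|exact: mA].
  apply/seteqP; split => w /=.
    by case=> i; rewrite ltnS leq_eqVlt => /orP[/eqP->|iM] Ai; [right|left; exists i].
  by case=> [[i iM Ai]|AM]; [exists i => //; exact: leqW|exists k].
split; first exact: mU.
have mD i : (i < M)%N -> measurable (D i).
  by move=> iM; apply: measurableD; [exact: mA|exact: mU (ltnW iM)].
have dD i j w : (i < M)%N -> (j < M)%N -> D i w -> D j w -> i = j.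
  move=> _ _ [Ai Hi] [Aj Hj]; case: (ltngtP i j) => // ij.
    by case: Hj; exists i.
  by case: Hi; exists j.
have [_ e] := pr_disj mD dD.
rewrite (_ : [set _ | _] = [set w | exists2 i, (i < M)%N & D i w]).
  rewrite e; apply: ler_sum => i _; apply: pr_le; [exact: mD|exact: mA|].
  by move=> w [].
apply/seteqP; split => w [i iM]; last by case; exists i.
elim/ltn_ind: i iM => i IHi iM Ai.
have [[j ji Aj]|H] := pselect (exists2 j, (j < i)%N & A j w).
  by apply: (IHi j) => //; exact: ltn_trans iM.
by exists i.
Qed.

(** Serves below to freeze the random graph [G m], so that sets determined by it become
    deterministic. *)
Lemma pr_total (I : finType) (X : T -> I) A : measurable A ->
  (forall t, measurable [set w | X w = t]) ->
  pr A = \sum_t pr (A `&` [set w | X w = t]).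
Proof.
move=> mA mX.
have m1 i : (i < #|I|)%N ->
    measurable (A `&` [set w | i = enum_rank (X w) :> nat]).
  move=> iI; rewrite (_ : [set _ | _] = [set w | X w = enum_val (Ordinal iI)]).
    exact: measurableI.
  apply/seteqP; split => w /= [].
    by move=> e; rewrite -(enum_rankK (X w)); congr enum_val; apply: val_inj.
  by move=> ->; rewrite enum_valK.
have [_ e] := pr_disj m1 (fun i j w _ _ wi wj => etrans wi.2 (esym wj.2)).
rewrite (reindex_onto enum_val enum_rank) => [|t _]; last exact: enum_rankK.
rewrite (_ : A = [set w | exists2 i, (i < #|I|)%N &
    (A `&` [set w | i = enum_rank (X w) :> nat]) w]); last first.
  apply/seteqP; split => w /=; last by case=> i _ [].
  by move=> Aw; exists (enum_rank (X w)).
rewrite e; apply: eq_big => [i|i _]; first by rewrite enum_valK eqxx.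
congr pr; apply/seteqP; split => w /=.
  case=> Aw wi; split; first by exists i => //.
  by rewrite -(enum_rankK (X w)); congr enum_val; apply: val_inj.
by case=> -[_ _ [Aw _]] wi; split => //; rewrite wi enum_valK.
Qed.

End RealProbability.

(** * Adaptedness of the process and independence of the offered vertices *)

Section Process.
Variables (R : realType) (d : measure_display) (T : measurableType d)
  (P : probability T R) (F : nat -> set (set T)) (l n : nat)
  (v : nat -> T -> {ffun 'I_l -> 'I_n.+1}) (E G : nat -> T -> graph n.+1).
Hypotheses (hF : is_filtration F) (hv : uniform_indep_tuples P F v)
  (hG : ell_vertex_rule F v E G) (hmerge : merging P F l G).
Local Notation pr := (pr P).
Local Notation N := (n.+1%:R : R).

Lemma filtration_sigma_algebra m : sigma_algebra setT (F m).
Proof. by case: (hF m). Qed.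
Let hS := filtration_sigma_algebra.

Lemma filtration_measurable m A : F m A -> measurable A.
Proof. by case: (hF m) => _ h _ /h. Qed.

Lemma filtration_le m m' : (m <= m')%N -> F m `<=` F m'.
Proof.
move/subnK <-; elim: (m' - m)%N => // t IHt A FA.
by rewrite addSn; case: (hF (t + m)) => _ _; apply; exact: IHt.
Qed.

Lemma filtration_graph m g : F m [set w | G m w = g].
Proof.
have [G0 Gs] := hG; elim: m g => [|m IHm] g.
  have [->|ng] := eqVneq g finset.set0.
    rewrite (_ : [set _ | _] = ~` set0).
      by apply: sigma_algebraC => //; exact: sigma_algebra0.
    by apply/seteqP; split => w /= _; [case|exact: G0].
  rewrite (_ : [set _ | _] = set0); first exact: sigma_algebra0.
  by apply/seteqP; split => // w /= Gg; rewrite -Gg G0 eqxx in ng.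
have [GE FE _ _] := Gs m.+1 isT.
rewrite (_ : [set _ | _] = [set w | [pred p : graph n.+1 * graph n.+1 |
    p.1 :|: p.2 == g] (G m w, E m.+1 w)]); last first.
  by apply/seteqP; split => w /=; rewrite GE => /eqP.
apply: sigma_algebra_fiber => // -[g1 g2].
rewrite (_ : [set _ | _] = [set w | G m w = g1] `&` [set w | E m.+1 w = g2]).
  by apply: sigma_algebraI => //; apply: (filtration_le (leqnSn m)); exact: IHm.
by apply/seteqP; split => w /=; [case=> -> ->|case=> -> ->].
Qed.

Lemma filtration_graph_pred i m (p : pred (graph n.+1)) : (i <= m)%N ->
  F m [set w | p (G i w)].
Proof.
move=> im; apply: (sigma_algebra_fiber (hS m) (X := G i)) => g.
exact: (filtration_le im (@filtration_graph i g)).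
Qed.

Lemma measurable_graph_pred i (p : pred (graph n.+1)) :
  measurable [set w | p (G i w)].
Proof. exact: (filtration_measurable (filtration_graph_pred p (leqnn i))). Qed.

Lemma measurable_graph i g : measurable [set w | G i w = g].
Proof. exact: filtration_measurable (@filtration_graph i g). Qed.

Lemma process_grows w : grows_on_values (v^~ w) (G^~ w).
Proof.
have [_ Gs] := hG; move=> m; have [/= GE _ EV _] := Gs m.+1 isT.
rewrite GE; split=> [|e]; first exact: finset.subsetUl.
rewrite finset.in_setU => /orP[|/EV[[i ->] [j ->] _]]; first by left.
by right; rewrite !imset_f.
Qed.

Lemma pr_values m A (D : {set {ffun 'I_l -> 'I_n.+1}}) : F m A ->
  pr (A `&` [set w | v m.+1 w \in D]) = pr A * (#|D|%:R / N ^+ l).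
Proof.
move=> FA; have [/= Fv vE] := hv (ltn0Sn m).
have mA := filtration_measurable FA.
have mv t := filtration_measurable (Fv t).
have mD : measurable [set w | v m.+1 w \in D].
  apply: (@filtration_measurable m.+1).
  exact: (@sigma_algebra_fiber _ _ (hS m.+1) _ _ (mem D) Fv).
rewrite (pr_total P _ mv) //; last exact: measurableI.
rewrite (eq_bigr (fun t => if t \in D then pr A / N ^+ l else 0)).
  by rewrite -big_mkcond sumr_const -[LHS]mulr_natl mulrCA.
move=> t _; case: ifPn => tD.
  rewrite (_ : _ `&` _ = A `&` [set w | v m.+1 w = t]); last first.
    by apply/seteqP; split => w /=; [case=> -[]|case=> ? ->].
  apply: EFin_inj; rewrite -prE; last exact: measurableI.
  by rewrite vE // (prE P mA) natrX.
rewrite (_ : _ `&` _ = set0) ?pr0 //.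
by apply/seteqP; split => // w /= [[_ +] vt]; rewrite vt (negPf tD).
Qed.

(** Each of the [l * t] choices avoids [S] with probability [1 - #|S| / N], independently of the
    past. Membership in [F (m + t)] belongs to the same induction because [pr_values] requires it
    for the next step. *)
Lemma pr_untouched m t A (S : {set 'I_n.+1}) : F m A ->
  F (m + t) (A `&` [set w | [disjoint S & touched (v^~ w) m t]%B]) /\
  pr (A `&` [set w | [disjoint S & touched (v^~ w) m t]%B]) =
    pr A * (1 - #|S|%:R / N) ^+ (l * t).
Proof.
move=> FA; elim: t => [|t [FI IHt]].
  rewrite addn0 muln0 expr0 mulr1 (_ : _ `&` _ = A) //.
  apply/seteqP; split => w /=; first by case.
  by move=> Aw; split=> //; rewrite /touched big_ord0 disjoint_sym finset.disjoints_subset finset.sub0set.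
pose D : {set {ffun 'I_l -> 'I_n.+1}} :=
  [set f : {ffun 'I_l -> 'I_n.+1} | [forall i, f i \notin S]]%SET.
have DE f : [disjoint S & values f]%B = (f \in D).
  rewrite finset.in_set; apply/idP/forallP => [/disjointFr dis i|H].
    by apply/negP => /dis; rewrite imset_f.
  rewrite disjoint_sym; apply/pred0P => x /=; apply/negP => /andP[/imsetP[i _ ->]].
  by rewrite (negPf (H i)).
have -> : A `&` [set w | [disjoint S & touched (v^~ w) m t.+1]%B] =
    A `&` [set w | [disjoint S & touched (v^~ w) m t]%B] `&`
    [set w | v (m + t).+1 w \in D].
  apply/seteqP; split => w /=; rewrite touchedS -!finset.setI_eq0 finset.setIUr finset.setU_eq0 !finset.setI_eq0 DE.
    by case=> ? /andP[].
  by case=> -[? ->] ->.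
split.
  rewrite addnS; apply: sigma_algebraI => //.
    exact: (filtration_le (leqnSn _) FI).
  have [Fv _] := hv (ltn0Sn (m + t)).
  exact: (@sigma_algebra_fiber _ _ (hS (m + t).+1) _ _ (mem D) Fv).
rewrite (pr_values D FI) IHt mulnSr exprD [RHS]mulrA; congr (_ * _).
have -> : #|D| = (#|~: S|%SET ^ l)%N.
  rewrite -[l in RHS]card_ord -card_ffun_on; apply: eq_card => f.
  rewrite finset.in_set; apply/forallP/ffun_onP => H i; have := H i.
    by rewrite finset.in_setC.
  by rewrite finset.in_setC.
rewrite natrX -expr_div_n; congr (_ ^+ _).
have := cardsC S; rewrite card_ord => /(congr1 (fun k => k%:R : R)).
by rewrite natrD => <-; field; rewrite -natrD pnatr_eq0 cardsC card_ord.
Qed.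

(** * Growth: the potential of a large set of vertices decreases *)

Variables (a delta : R).
Hypotheses (l0 : (0 < l)%N) (a0 : 0 <= a) (d0 : 0 < delta) (d1 : delta <= 1).
Local Notation alpha := (a + (2 * l)%:R * delta).
Local Notation q := (delta ^+ l).

(** Let [W'] be the part of [W] in components of size at most [delta * N]. If [W'] has at least
    [2 * l * delta * N] vertices, the offered vertices lie in [W'] and in distinct components with
    probability at least [q], and the rule must then add an edge. Otherwise two components larger
    than [delta * N] meet [W], and the merging property joins them with probability at least [q]. *)
Lemma pr_drop m A g (W : {set 'I_n.+1}) : F m A -> A `<=` [set w | G m w = g] ->
  (L1 g)%:R <= a * N -> alpha * N <= #|W|%:R ->
  q * pr A <= pr (A `&` [set w | (ncomps W (G m.+1 w) < ncomps W g)%N]).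
Proof.
move=> FA Ag La Wa.
have mA := filtration_measurable FA.
have mdrop := measurable_graph_pred m.+1 (fun g' => ncomps W g' < ncomps W g)%N.
have sG w : A w -> g \subset G m.+1 w.
  by move=> /Ag <-; case: (process_grows w m).
pose W' : {set 'I_n.+1} := [set x in W | #|comp g x|%:R <= delta * N]%SET.
have sW'W : W' \subset W by apply/fintype.subsetP => x; rewrite finset.in_set => /andP[].
have [big|small] := leP ((2 * l)%:R * (delta * N)) #|W'|%:R.
  have dN : 0 <= delta * N by rewrite mulr_ge0 // ltW.
  have W'd x : x \in W' -> #|comp g x|%:R <= delta * N.
    by rewrite finset.in_set => /andP[].
  have := card_spread_ffun dN W'd big; set D := finset _ => cD.
  apply: (@le_trans _ _ (pr (A `&` [set w | v m.+1 w \in D]))).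
    rewrite (pr_values D FA) mulrC ler_wpM2l ?pr_ge0 //.
    by rewrite ler_pdivlMr ?exprn_gt0 // -exprMn.
  have [/= Fv _] := hv (ltn0Sn m).
  have mD : measurable [set w | v m.+1 w \in D].
    apply: (@filtration_measurable m.+1).
    exact: (@sigma_algebra_fiber _ _ (hS m.+1) _ _ (mem D) Fv).
  apply: pr_le; [exact: measurableI|exact: measurableI|] => w [Aw /=].
  rewrite finset.in_set => /andP[/forallP vW /forallP vfar]; split => //.
  have [_ Gs] := hG; have [/= GE _ EV En] := Gs m.+1 isT.
  have : E m.+1 w != finset.set0.
    apply: En => i j ij; rewrite (Ag _ Aw).
    by have /forallP/(_ j)/implyP := vfar i; exact.
  case/set0Pn => e eE; have [[i ei] [j ej] ne] := EV w e eE.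
  have ij : i != j by apply: contraNneq ne => ij; rewrite ei ej ij.
  apply: (@ncomps_drop _ _ _ _ e.1 e.2); first exact: sG.
  - by rewrite ei (fintype.subsetP sW'W).
  - by rewrite ej (fintype.subsetP sW'W).
  - by rewrite ei ej; have /forallP/(_ j)/implyP := vfar i; exact.
  - apply: connect1; rewrite /adj GE finset.in_setU.
    by rewrite -surjective_pairing eE orbT.
have cW : #|W|%:R = #|W'|%:R + #|W :\: W'|%SET%:R :> R.
  by rewrite -natrD -(cardsID W' W) (finset.setIidPr sW'W).
have aW : a * N < #|W :\: W'|%SET%:R by move: Wa small; rewrite cW; lra.
have aN : 0 <= a * N by rewrite mulr_ge0.
have : (0 < #|W :\: W'|%SET)%N by rewrite -(ltr_nat R); exact: le_lt_trans aW.
rewrite card_gt0 => /set0Pn[x xW].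
(* More than [a * N] vertices remain, and no component of [g] is that large, so the component of [x]
   misses one of them. *)
have /subsetPn[y yW yx] : ~~ ((W :\: W')%SET \subset comp g x).
  apply/negP => /subset_leq_card; apply/negP; rewrite -ltnNge -(ltr_nat R).
  by apply: le_lt_trans aW; apply: le_trans La; rewrite ler_nat card_comp_le_L1.
have bigW z : z \in (W :\: W')%SET -> z \in W /\ delta * N <= #|comp g z|%:R.
  rewrite finset.in_setD finset.in_set => /andP[+ zW]; rewrite zW /= -ltNge => /ltW.
  by split.
have [xW1 xb] := bigW x xW; have [yW1 yb] := bigW y yW.
have := hmerge d0 (ltn0Sn m) x y FA; cbv zeta; rewrite /=.
set B := [set w | _]; have AB : A `&` B = A.
  apply/setIidl => w Aw; rewrite /B /= (Ag _ Aw); split => //.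
  by rewrite finset.in_set in yx.
have mc := measurable_graph_pred m.+1 (fun g' => connect (adj g') x y).
rewrite AB !prE //; last exact: measurableI.
rewrite -EFinM lee_fin => /le_trans; apply.
apply: pr_le; [exact: measurableI|exact: measurableI|] => w [Aw /= xyw].
split => //=; apply: (@ncomps_drop _ _ _ _ x y) => //; first exact: sG.
by rewrite finset.in_set in yx.
Qed.

(* The process [2 ^ ncomps W (G m)], killed once [L1 > a N], is multiplied in
   conditional expectation by at most [1 - q / 2] at each step. *)
Lemma pr_stuck i m A (W : {set 'I_n.+1}) z : F m A ->
  A `<=` [set w | (ncomps W (G m w) <= z)%N] -> alpha * N <= #|W|%:R ->
  pr (A `&` [set w | (L1 (G (m + i) w))%:R <= a * N]) <=
    2 ^+ z * (1 - q / 2) ^+ i * pr A.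
Proof.
move=> FA Az Wa.
have q1 : q <= 1 by apply: exprn_ile1 => //; exact: ltW.
have q0 : 0 < q by rewrite exprn_gt0.
have rho0 j : 0 <= (1 - q / 2) ^+ j by apply: exprn_ge0; lra.
elim: i m A z FA Az => [|i IHi] m A z FA Az.
  rewrite addn0 expr0 mulr1; apply: (@le_trans _ _ (pr A)).
    have mA := filtration_measurable FA.
    have mL := measurable_graph_pred m (fun g => (L1 g)%:R <= a * N).
    by apply: pr_le => //; exact: measurableI.
  by rewrite ler_peMl ?pr_ge0 // exprn_ege1 // ler1n.
pose L j := [set w | (L1 (G j w))%:R <= a * N].
have FL j : F j (L j).
  exact: (filtration_graph_pred (fun g => (L1 g)%:R <= a * N) (leqnn j)).
have mL j := filtration_measurable (FL j).
(* By monotonicity of [L1], the bound at time [m + i.+1] implies the one at time [m], so [A] may be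
   replaced by [A1]. *)
pose A1 := A `&` L m.
have FA1 : F m A1 by exact: sigma_algebraI.
have mA := filtration_measurable FA; have mA1 := filtration_measurable FA1.
pose Dr := [set w | (ncomps W (G m.+1 w) < z)%N].
have FDr : F m.+1 Dr.
  exact: (filtration_graph_pred (fun g => ncomps W g < z)%N (leqnn _)).
have mDr := filtration_measurable FDr.
have drop : q * pr A1 <= pr (A1 `&` Dr).
  rewrite (pr_total P mA1 (measurable_graph m)).
  rewrite (pr_total P (measurableI _ _ mA1 mDr) (measurable_graph m)).
  rewrite mulr_sumr; apply: ler_sum => g _.
  have [[w0 [[Aw0 Lw0] /= Gw0]]|H] := pselect (exists w, (A1 `&` [set w | G m w = g]) w).
    have FAg : F m (A1 `&` [set w | G m w = g]).
      by apply: sigma_algebraI => //; exact: filtration_graph.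
    have Ag : A1 `&` [set w | G m w = g] `<=` [set w | G m w = g] by move=> w [].
    have Lg : (L1 g)%:R <= a * N by rewrite -Gw0.
    apply: le_trans (pr_drop FAg Ag Lg Wa) _.
    apply: pr_le.
    - apply: measurableI; first exact: filtration_measurable FAg.
      exact: (measurable_graph_pred m.+1 (fun g' => ncomps W g' < ncomps W g)%N).
    - by apply: measurableI; [exact: measurableI|exact: measurable_graph].
    - move=> w [[[Aw Lw] Gw] /= dw]; split; last exact: Gw.
      split; first by split.
      rewrite /Dr /=.
      by apply: leq_trans dw _; rewrite -Gw; exact: Az.
  rewrite (_ : A1 `&` _ = set0) ?pr0 ?mulr0 ?pr_ge0 //.
  by apply/seteqP; split => // w Hw; apply: H; exists w.
have FA1' : F m.+1 A1 by exact: filtration_le FA1.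
have FD1 : F m.+1 (A1 `&` Dr) by exact: sigma_algebraI.
have FD2 : F m.+1 (A1 `\` Dr).
  by rewrite setDE; apply: sigma_algebraI => //; exact: sigma_algebraC.
have mLi := mL (m + i.+1)%N.
have -> : A `&` L (m + i.+1)%N = A1 `&` L (m + i.+1)%N.
  apply/seteqP; split => w [Aw Lw]; last by case: Aw.
  split => //; split => //; apply: le_trans Lw; rewrite ler_nat.
  by apply: L1_mono; apply: (graph_mono (process_grows w)); exact: leq_addr.
have sp : pr (A1 `&` L (m + i.+1)%N) =
    pr (A1 `&` Dr `&` L (m + i.+1)%N) + pr ((A1 `\` Dr) `&` L (m + i.+1)%N).
  rewrite (pr_split P (measurableI _ _ mA1 mLi) mDr).
  by congr (pr _ + pr _); rewrite ?setDE setIAC.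
have prA : pr A1 <= pr A by apply: pr_le => // w [].
have sp1 := pr_split P mA1 mDr.
have le2 := IHi m.+1 _ z FD2 _; rewrite addSnnS in le2.
have {}le2 := le2 (fun w Hw => leq_trans
   (ncomps_mono W (process_grows w m).1) (Az w Hw.1.1)).
(* For [z = 0] a drop is impossible, so its lower bound [q * pr A1] forces [A1] to be null. *)
case: z Az @Dr FDr mDr drop FD1 FD2 sp sp1 le2 => [|z] Az Dr FDr mDr drop FD1 FD2 sp sp1 le2.
  have D0 : A1 `&` Dr = set0 by apply/seteqP; split => // w [].
  have : pr A1 = 0.
    apply/eqP; rewrite eq_le pr_ge0 andbT -(pmulr_rle0 _ q0).
    by apply: le_trans drop _; rewrite D0 pr0.
  move=> e; apply: (@le_trans _ _ (pr A1)); last by rewrite e !mulr_ge0 ?pr_ge0 ?rho0 ?exprn_ge0.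
  by apply: pr_le => //; exact: measurableI.
have le1 := IHi m.+1 _ z FD1 (fun w Hw => Hw.2); rewrite addSnnS in le1.
rewrite sp; apply: le_trans (lerD le1 le2) _.
have r0 := rho0 i; set r := (1 - q / 2) ^+ i in r0 le1 le2 *.
have s0 : 0 <= 2 ^+ z :> R by rewrite exprn_ge0.
rewrite !exprS -/r; set s := 2 ^+ z in s0 *.
(* A drop halves the weight [2 ^+ z.+1], and it happens on a proportion at least [q] of [A1]; this
   yields the factor [2 - q]. *)
have e : s * r * pr (A1 `&` Dr) + 2 * s * r * pr (A1 `\` Dr) =
   (s * r) * (2 * pr A1 - pr (A1 `&` Dr)) by rewrite sp1; ring.
rewrite e [leRHS](_ : _ = (s * r) * ((2 - q) * pr A)); last by field.
apply: ler_wpM2l; first exact: mulr_ge0.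
apply: (@le_trans _ _ ((2 - q) * pr A1)); first lra.
by apply: ler_wpM2l => //; lra.
Qed.

Variables (C : nat).
Hypothesis hC : (1 - q / 2) ^+ C <= 4^-1.

(** With [r = n.+1 %/ k], the initial weight is at most [2 ^+ r], while each of the [r.+1] blocks of
    [C] steps gains a factor 4. *)
Lemma pr_stuck_in_comp_ge m k A : F m A -> (0 < k)%N ->
  A `<=` [set w | alpha * N <= #|in_comp_ge k (G m w)|%:R] ->
  pr (A `&` [set w | (L1 (G (m + C * (n.+1 %/ k).+1) w))%:R <= a * N]) <=
    2^-1 ^+ (n.+1 %/ k) * pr A.
Proof.
move=> FA k0 Ak; have mA := filtration_measurable FA.
set t := (C * _)%N.
have mL := measurable_graph_pred (m + t) (fun g => (L1 g)%:R <= a * N).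
rewrite (pr_total P mA (measurable_graph m)).
rewrite (pr_total P (measurableI _ _ mA mL) (measurable_graph m)).
rewrite mulr_sumr; apply: ler_sum => g _.
have FAg : F m (A `&` [set w | G m w = g]).
  by apply: sigma_algebraI => //; exact: filtration_graph.
rewrite setIAC.
have [[w0 [Aw0 /= Gw0]]|H] := pselect (exists w, (A `&` [set w | G m w = g]) w); last first.
  rewrite (_ : A `&` [set w | G m w = g] = set0) ?set0I ?pr0 ?mulr0 //.
  by apply/seteqP; split => // w Hw; apply: H; exists w.
have Wa : alpha * N <= #|in_comp_ge k g|%:R by rewrite -Gw0; exact: Ak.
have := @pr_stuck t m _ (in_comp_ge k g) (n.+1 %/ k) FAg _ Wa.
move=> /(_ _)/le_trans; apply.
  by move=> w [_ /= ->]; rewrite leq_divRL // ncomps_in_comp_ge.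
apply: ler_wpM2r; first exact: pr_ge0.
set r := (n.+1 %/ k)%N.
have q1 : q <= 1 by apply: exprn_ile1 => //; exact: ltW.
have q0 : 0 < q by rewrite exprn_gt0.
have rho0 : 0 <= (1 - q / 2) ^+ C by apply: exprn_ge0; lra.
have le4 : (1 - q / 2) ^+ t <= (4^-1 : R) ^+ r.
  rewrite /t exprM; apply: (@le_trans _ _ (4^-1 ^+ r.+1)).
    by apply: lerXn2r; rewrite // nnegrE ?invr_ge0.
  by rewrite exprS ler_piMl ?exprn_ge0 ?invr_ge0 // invf_le1 // ler1n.
apply: (@le_trans _ _ (2 ^+ r * 4^-1 ^+ r)).
  by apply: ler_wpM2l => //; rewrite exprn_ge0.
by rewrite -exprMn (_ : 2 * 4^-1 = 2^-1) //; field.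
Qed.

Lemma filtration_touched m t (U : {set 'I_n.+1}) :
  F (m + t) [set w | touched (v^~ w) m t = U].
Proof.
elim: t U => [|t IHt] U.
  rewrite addn0 (_ : [set _ | _] = [set w | (fun=> finset.set0 == U) (G m w)]).
    exact: (filtration_graph_pred (fun=> finset.set0 == U) (leqnn m)).
  by apply/seteqP; split => w /=; rewrite /touched big_ord0 => /eqP.
have [Fv _] := hv (ltn0Sn (m + t)).
pose X w := (touched (v^~ w) m t, v (m + t).+1 w).
pose p (X : {set 'I_n.+1} * {ffun 'I_l -> 'I_n.+1}) := X.1 :|: values X.2 == U.
rewrite (_ : [set _ | _] = [set w | p (X w)]); last first.
  by apply/seteqP; split => w /=; rewrite touchedS => /eqP.
rewrite addnS; apply: (@sigma_algebra_fiber _ _ (hS _) _ X p) => -[U1 f].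
rewrite (_ : [set _ | _] = [set w | touched (v^~ w) m t = U1] `&`
   [set w | v (m + t).+1 w = f]).
  by apply: sigma_algebraI => //; exact: (filtration_le (leqnSn _) (IHt U1)).
by apply/seteqP; split => w /=; [case=> -> ->|rewrite /X; case=> -> ->].
Qed.

Lemma measurable_untouched m t x :
  measurable [set w | [disjoint comp (G m w) x & touched (v^~ w) m t]%B].
Proof.
pose X w := (G m w, touched (v^~ w) m t).
pose p (X : graph n.+1 * {set 'I_n.+1}) := [disjoint comp X.1 x & X.2]%B.
apply: (@filtration_measurable (m + t)).
apply: (@sigma_algebra_fiber _ _ (hS _) _ X p) => -[g U].
rewrite (_ : [set _ | _] = [set w | G m w = g] `&` [set w | touched (v^~ w) m t = U]).
  apply: sigma_algebraI => //; last exact: filtration_touched.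
  by apply: (filtration_le (leq_addr _ _)); exact: filtration_graph.
by apply/seteqP; split => w /=; [case=> -> ->|rewrite /X; case=> -> ->].
Qed.

(** * Scales: disjoint ranges of component sizes *)

Variables (b h : R) (B J : nat).
(** [hB] bounds by [(b - alpha) / 4 * N] the main term of the growth out of components smaller than
    [B ^ j] during the wait. [hBJ] keeps the scales below [N / 2]. [hh] absorbs the duration [h] of
    the jump, the overshoot of one step and the rounding of the wait. *)
Hypotheses (hb : alpha < b) (hB2 : (1 < B)%N)
  (hB : 4 * (l * C)%:R <= (b - alpha) * B%:R)
  (hBJ : (2 * B ^ J <= n.+1)%N)
  (hh : (B ^ J * l)%:R * (h + 1 + C%:R) <= (b - alpha) / 4 * N).

(* For each scale [j], [first j m] is the event [sigma = m] of the stopping time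
   [sigma] for [k = B ^ j.+1]; [active j m] and [survive j x m] concern the
   components of size in [B ^ j, B ^ j.+1) at that time, and [stuck j m] is the
   exceptional event of the growth argument. *)
Let scale j (g : graph n.+1) : {set 'I_n.+1} :=
  (in_comp_ge (B ^ j) g :\: in_comp_ge (B ^ j.+1) g)%SET.
Let wait j := (C * (n.+1 %/ B ^ j.+1).+1)%N.
Let reach j (g : graph n.+1) : bool := alpha * N <= #|in_comp_ge (B ^ j.+1) g|%:R.
Let first j m := [set w | reach j (G m w)] `&`
  [set w | forall i, (i < m)%N -> ~~ reach j (G i w)].
Let active_graph j (g : graph n.+1) : bool :=
  ((L1 g)%:R <= a * N) && ((b - alpha) / 2 * N <= #|scale j g|%:R).
Let active j m := first j m `&` [set w | active_graph j (G m w)].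
Let survive j x m := active j m `&` [set w | x \in scale j (G m w)] `&`
  [set w | [disjoint comp (G m w) x & touched (v^~ w) m (wait j)]%B].
Let stuck j m := first j m `&` [set w | (L1 (G (m + wait j) w))%:R <= a * N].

Let filtration_first j m : F m (first j m).
Proof.
apply: sigma_algebraI => //.
  exact: (filtration_graph_pred (reach j) (leqnn m)).
suff H r : (r <= m)%N -> F m [set w | forall i, (i < r)%N -> ~~ reach j (G i w)] by exact: H.
elim: r => [_|r IHr rm].
  rewrite (_ : [set _ | _] = ~` set0).
    by apply: sigma_algebraC => //; exact: sigma_algebra0.
  by apply/seteqP; split => w /= _; [case|].
rewrite (_ : [set _ | _] = [set w | forall i, (i < r)%N -> ~~ reach j (G i w)] `&`
    [set w | ~~ reach j (G r w)]).
  apply: sigma_algebraI => //; first exact: IHr (ltnW rm).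
  exact: (filtration_graph_pred (fun g => ~~ reach j g) (ltnW rm)).
apply/seteqP; split => w /=.
  by move=> H; split=> [i ir|]; apply: H => //; exact: ltnW.
by move=> [H1 H2] i; rewrite ltnS leq_eqVlt => /orP[/eqP->//|/H1].
Qed.

Let filtration_active j m : F m (active j m).
Proof.
by apply: sigma_algebraI => //; exact: (filtration_graph_pred (active_graph j) (leqnn m)).
Qed.

Let measurable_survive j x m : measurable (survive j x m).
Proof.
apply: measurableI; last exact: measurable_untouched.
apply: measurableI; first exact: filtration_measurable (filtration_active j m).
exact: (measurable_graph_pred m (fun g => x \in scale j g)).
Qed.

Let measurable_stuck j m : measurable (stuck j m).
Proof.
apply: measurableI; first exact: filtration_measurable (filtration_first j m).
exact: (measurable_graph_pred _ (fun g => (L1 g)%:R <= a * N)).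
Qed.

Let first_inj j m m' w : first j m w -> first j m' w -> m = m'.
Proof.
move=> [/= r1 H1] [/= r2 H2]; case: (ltngtP m m') => // lt.
  by move: (H2 _ lt); rewrite r1.
by move: (H1 _ lt); rewrite r2.
Qed.

Let B_gt0 j : (0 < B ^ j)%N.
Proof. by rewrite expn_gt0 (ltnW hB2). Qed.

Let leB j : (j < J)%N -> (B ^ j.+1 <= B ^ J)%N.
Proof. by move=> jJ; rewrite leq_exp2l. Qed.

(** Since [expR (2 * y) >= 1 + 2 * y], it suffices that [(1 - y) * (1 + 2 * y) = 1 + y * (1 - 2 *
    y)] is at least 1. *)
Lemma expR_le_onem (y : R) : 0 <= y -> y <= 2^-1 -> expR (- (2 * y)) <= 1 - y.
Proof.
move=> y0 y1; rewrite expRN; apply: (@le_trans _ _ (1 + 2 * y)^-1).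
  by rewrite lef_pV2 ?posrE ?expR_gt0 ?expR_ge1Dx //; lra.
rewrite -[leLHS]mul1r ler_pdivrMr; last lra.
have : 0 <= y * (1 - 2 * y) by rewrite mulr_ge0 //; lra.
lra.
Qed.

(** As [s <= k], the product of [s / N] and [n.+1 %/ k + 1] is at most [1 + k / N <= 2], so the
    bound does not depend on the scale. *)
Let survival_rate j s : (j < J)%N -> (s <= B ^ j.+1)%N ->
  expR (- (4 * (l * C)%:R)) <= (1 - s%:R / N) ^+ (l * wait j).
Proof.
move=> jJ sk; set k := (B ^ j.+1)%N in sk *.
have kJ : (2 * k <= n.+1)%N by apply: leq_trans hBJ; rewrite leq_mul2l leB.
have N0 : 0 < N by [].
have y0 : 0 <= s%:R / N by rewrite divr_ge0.
have y1 : s%:R / N <= 2^-1.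
  by rewrite ler_pdivrMr // ler_pdivlMl // -natrM ler_nat (leq_trans _ kJ) // leq_mul2l.
apply: (@le_trans _ _ (expR (- (2 * (s%:R / N))) ^+ (l * wait j))); last first.
  apply: lerXn2r; rewrite ?nnegrE ?expR_ge0 //.
    by rewrite subr_ge0 (le_trans y1) // invf_le1 // ler1n.
  exact: expR_le_onem.
rewrite -expRM_natl ler_expR mulrN lerN2.
have H : (s * (n.+1 %/ k).+1 <= 2 * n.+1)%N.
  apply: (@leq_trans (k * (n.+1 %/ k).+1)); first by rewrite leq_mul2r sk orbT.
  rewrite mulnS mulSn mul1n leq_add //; first by apply: leq_trans kJ; rewrite leq_pmull.
  by rewrite mulnC leq_trunc_div.
have {H} : s%:R / N * (n.+1 %/ k).+1%:R <= 2 :> R.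
  by rewrite mulrAC ler_pdivrMr // -!natrM ler_nat.
move=> /(ler_wpM2l (_ : 0 <= 2 * (l * C)%:R)) H.
rewrite /wait -/k mulnA natrM.
have {}H := H (mulr_ge0 (ler0n R 2) (ler0n R _)).
by apply: le_trans (le_trans _ H) _; rewrite le_eqVlt; apply/orP; left; apply/eqP; ring.
Qed.

(** Survival probability of a component times the fraction of vertices at an active scale. *)
Let kappa : R := expR (- (4 * (l * C)%:R)) * ((b - alpha) / 2).

Let kappa_ge0 : 0 <= kappa.
Proof. by rewrite mulr_ge0 ?expR_ge0 // divr_ge0 // subr_ge0 ltW. Qed.

Let pr_survive j m : (j < J)%N ->
  kappa * N * pr (active j m) <= \sum_x pr (survive j x m).
Proof.
move=> jJ; have mA := filtration_measurable (filtration_active j m).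
rewrite (pr_total P mA (measurable_graph m)).
under [leRHS]eq_bigr do rewrite (pr_total P (measurable_survive _ _ _) (measurable_graph m)).
rewrite exchange_big mulr_sumr; apply: ler_sum => g _.
have [[w0 [[_ /= Aw0] /= Gw0]]|H] :=
    pselect (exists w, (active j m `&` [set w | G m w = g]) w); last first.
  rewrite (_ : active j m `&` _ = set0); last first.
    by apply/seteqP; split => // w Hw; apply: H; exists w.
  by rewrite pr0 mulr0; apply: sumr_ge0 => x _; exact: pr_ge0.
move: Aw0; rewrite Gw0 => /andP[_ gscale].
have FAg : F m (active j m `&` [set w | G m w = g]).
  by apply: sigma_algebraI => //; exact: filtration_graph.
set pA := pr _.
rewrite (bigID (fun x => x \in scale j g)) /= -[leLHS]addr0; apply: lerD; last first.
  by apply: sumr_ge0 => x _; exact: pr_ge0.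
apply: (@le_trans _ _ (\sum_(x in scale j g) expR (- (4 * (l * C)%:R)) * pA)).
  rewrite sumr_const -[leRHS]mulr_natl [leRHS]mulrA ler_wpM2r ?pr_ge0 //.
  by rewrite /kappa -mulrA [leRHS]mulrC ler_wpM2l ?expR_ge0.
apply: ler_sum => x xg.
have [_ e] := pr_untouched (wait j) (comp g x) FAg.
rewrite (_ : survive j x m `&` _ = active j m `&` [set w | G m w = g] `&`
   [set w | [disjoint comp g x & touched (v^~ w) m (wait j)]%B]).
  rewrite e mulrC ler_wpM2l ?pr_ge0 //; apply: survival_rate => //.
  by move: xg; rewrite !finset.in_set -ltnNge => /andP[/ltnW].
apply/seteqP; split => w /=.
  by move=> [[[Aw _] /= dw] Gw]; rewrite Gw in dw; split.
by move=> [[Aw Gw] dw]; rewrite /survive /= Gw; split.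
Qed.

Let pr_stuck_first j m : pr (stuck j m) <= 2^-1 ^+ (n.+1 %/ B ^ j.+1) * pr (first j m).
Proof. by apply: pr_stuck_in_comp_ge => // w []. Qed.

(* If neither growth fails, the two waiting windows both contain the later of the
   two starting times, at which the component of [x] has both scales. *)
Let survive_inj i j x m m' w : survive i x m w -> survive j x m' w ->
  ~ stuck i m w -> ~ stuck j m' w -> i = j.
Proof.
wlog mm' : i j m m' / (m <= m')%N.
  move=> H si sj ni nj; case: (leqP m m') => [mm'|/ltnW mm'].
    exact: (H i j m m').
  by apply/esym/(H j i m' m).
move=> [[[fi /= /andP[Li _]] /= xi] /= di] [[[fj /= /andP[Lj _]] /= xj] /= dj] ni nj.
(* [L1] is still at most [a * N] at time [m']; were the window of [i] over by then, [stuck i m]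
   would hold. *)
have m'w : (m' <= m + wait i)%N.
  rewrite leqNgt; apply/negP => /ltnW le; apply: ni; split => //=.
  apply: le_trans Lj; rewrite ler_nat; apply: L1_mono.
  exact: (graph_mono (process_grows w)).
have e : comp (G m' w) x = comp (G m w) x.
  rewrite -(subnKC mm'); apply: (comp_untouched_steps (process_grows w)).
  have sub : touched (v^~ w) m (m' - m) \subset touched (v^~ w) m (wait i).
    by apply: touched_sub; rewrite leq_subLR.
  by rewrite disjoint_sym (disjointWl sub) // disjoint_sym.
move: xi xj; rewrite !finset.in_set e -!ltnNge => /andP[i1 i2] /andP[j1 j2].
have := leq_ltn_trans i2 j1; have := leq_ltn_trans j2 i1.
by rewrite !ltn_exp2l // !ltnS; move=> H1 H2; apply/eqP; rewrite eqn_leq H1 H2.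
Qed.

(** One step before [m] the threshold was not reached, and a single step adds at most [B ^ j.+1 * l]
    vertices. At time 0 all components are singletons, smaller than [B ^ j.+1]. *)
Let card_reach_first j m w : first j m w ->
  #|in_comp_ge (B ^ j.+1) (G m w)|%:R <= alpha * N + (B ^ j.+1 * l)%:R.
Proof.
have al0 : 0 <= alpha * N by rewrite mulr_ge0 // addr_ge0 // mulr_ge0 // ltW.
case: m => [_|m [_ /= /(_ m (ltnSn m))]].
  have [G0 _] := hG.
  have comp0 (x : 'I_n.+1) : comp finset.set0 x = [set x]%SET.
    apply/setP => y; rewrite finset.in_set finset.in_set1 eq_sym.
    apply/idP/eqP => [/connectP[[|z p] //=]|->]; last exact: connect0.
    by rewrite /adj !finset.in_set0.
  rewrite (_ : in_comp_ge _ _ = finset.set0).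
    by rewrite cards0 addr_ge0.
  apply/setP => x; rewrite finset.in_set finset.in_set0 G0 comp0 cards1.
  by rewrite leqNgt -(expn0 B) ltn_exp2l.
rewrite -ltNge => /ltW lt.
have := card_in_comp_ge_steps (process_grows w) m 1 (leqnn (B ^ j.+1)).
by rewrite addn1 mul1n -(ler_nat R) natrD => /le_trans; apply; rewrite lerD2r.
Qed.

Let jumps m1 := [set w | exists m2 : nat, [/\ (L1 (G m1 w))%:R <= a * N,
  b * N <= (L1 (G m2 w))%:R & m2%:R <= m1%:R + h]].

(** The witness is the first time the threshold is reached. Between it and [m1] the vertices in
    components of size at least [k] increase from about [alpha * N] to about [b * N], and few of
    them can come from components smaller than [B ^ j]. *)
Let jumps_active j m1 w : (j < J)%N -> jumps m1 w ->
  (forall m, (m <= m1)%N -> ~ stuck j m w) -> exists2 m, (m <= m1)%N & active j m w.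
Proof.
move=> jJ [m2 [La Lb m12]] nstuck.
have Gm m m' : (m <= m')%N -> G m w \subset G m' w.
  exact: (graph_mono (process_grows w)).
have N0 : 0 < N by [].
have ab : a < b.
  by apply: le_lt_trans hb; rewrite lerDl mulr_ge0 // ltW.
have le12 : (m1 <= m2)%N.
  rewrite leqNgt; apply/negP => /ltnW/Gm/L1_mono; rewrite -(ler_nat R) => le21.
  have : a * N < b * N by rewrite ltr_pM2r.
  by move: La Lb le21; lra.
have h0 : 0 <= h by move: le12; rewrite -(ler_nat R); lra.
set k := (B ^ j.+1)%N.
have kJ : k%:R <= (B ^ J)%:R :> R by rewrite ler_nat leB.
have l1 : 1 <= l%:R :> R by rewrite ler1n.
have klJ : (k * l)%:R <= (B ^ J * l)%:R :> R by rewrite ler_nat leq_mul2r leB ?orbT.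
have kk : k%:R <= (k * l)%:R :> R by rewrite ler_nat leq_pmulr.
have C0 : 0 <= C%:R :> R by [].
have kl0 : 0 <= (k * l)%:R :> R by [].
have hk : (k * l)%:R * (h + 1 + C%:R) <= (b - alpha) / 4 * N.
  by apply: le_trans hh; apply: ler_wpM2r => //; lra.
have klh : 0 <= (k * l)%:R * h by rewrite mulr_ge0.
have klC : 0 <= (k * l)%:R * C%:R :> R by rewrite mulr_ge0.
have al0 : 0 <= alpha * N by rewrite mulr_ge0 // addr_ge0 // mulr_ge0 // ltW.
have ba0 : 0 < (b - alpha) * N by rewrite mulr_gt0 // subr_gt0.
(* The largest component at time [m2] has at least [b * N >= k] vertices, so all of them are
   counted. *)
have V2 : b * N <= #|in_comp_ge k (G m2 w)|%:R.
  apply: (le_trans Lb); rewrite ler_nat.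
  have [x0 ex] : {x0 | L1 (G m2 w) = #|comp (G m2 w) x0|}.
    by apply: bigop.eq_bigmax; rewrite card_ord.
  rewrite ex; apply/subset_leq_card/fintype.subsetP => y.
  rewrite finset.in_set => xy; rewrite finset.in_set -(eq_comp xy) -ex.
  by rewrite -(ler_nat R); apply: le_trans Lb; move: hk; nra.
have V1 : b * N <= #|in_comp_ge k (G m1 w)|%:R + (k * l)%:R * h.
  have := card_in_comp_ge_steps (process_grows w) m1 (m2 - m1) (leqnn k).
  rewrite subnKC // -(ler_nat R) natrD => /(le_trans V2)/le_trans; apply.
  rewrite lerD2l mulnCA mulnC natrM; apply: ler_wpM2l => //.
  by rewrite natrB //; lra.
have r1 : reach j (G m1 w) by rewrite /reach -/k; move: hk; lra.
have [m rm mmin] := @ex_minnP (fun m => reach j (G m w)) (ex_intro _ m1 r1).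
have mm1 : (m <= m1)%N by exact: mmin.
have fm : first j m w.
  by split => //= i im; apply/negP => /mmin; rewrite leqNgt im.
exists m => //; split => //=.
have Lm : (L1 (G m w))%:R <= a * N.
  by apply: le_trans La; rewrite ler_nat L1_mono // Gm.
rewrite /active_graph Lm /=.
(* A longer delay would keep [L1] at most [a * N] throughout the wait, which is the event
   [stuck j m]. *)
have tw : (m1 - m <= wait j)%N.
  rewrite leq_subLR leqNgt; apply/negP => /ltnW/Gm/L1_mono le.
  by apply: (nstuck m mm1); split => //=; apply: le_trans La; rewrite ler_nat.
have Vm := card_reach_first fm; rewrite -/k in Vm.
have leBk : (B ^ j <= k)%N by rewrite leq_exp2l.
have := card_in_comp_ge_steps (process_grows w) m (m1 - m) leBk.
rewrite subnKC // -(ler_nat R) natrD => V1m.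
(* The quotient in the wait costs a quarter of [(b - alpha) * N] by [hB]; rounding it up costs the
   term with [C]. *)
have st : (B ^ j * ((m1 - m) * l))%:R <= (b - alpha) / 4 * N + (k * l)%:R * C%:R.
  apply: (@le_trans _ _ (B ^ j * (wait j * l))%:R).
    by rewrite ler_nat leq_mul2l leq_mul2r tw !orbT.
  rewrite /wait -/k; set r := (n.+1 %/ k)%N.
  have rN : ((B ^ j * r)%:R : R) * B%:R <= N.
    rewrite -natrM ler_nat mulnAC -expnSr mulnC; exact: leq_trunc_div.
  have e1 : (B ^ j * (C * r.+1 * l))%:R =
      (B ^ j * r)%:R * (l * C)%:R + (B ^ j * l)%:R * C%:R :> R.
    by rewrite !natrM -natr1; ring.
  rewrite e1; apply: lerD; last first.
    by apply: ler_wpM2r => //; rewrite ler_nat leq_mul2r leBk orbT.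
  have e2 : (B ^ j * r)%:R * (4 * (l * C)%:R) <= (B ^ j * r)%:R * ((b - alpha) * B%:R).
    by apply: ler_wpM2l.
  have e3 : (b - alpha) * ((B ^ j * r)%:R * B%:R) <= (b - alpha) * N.
    by apply: ler_wpM2l => //; rewrite subr_ge0 ltW.
  by move: e2 e3; set X := (B ^ j * r)%:R; set Y := (l * C)%:R; lra.
have cs : #|scale j (G m w)|%:R =
    #|in_comp_ge (B ^ j) (G m w)|%:R - #|in_comp_ge k (G m w)|%:R :> R.
  have sub : in_comp_ge k (G m w) \subset in_comp_ge (B ^ j) (G m w).
    by apply/fintype.subsetP => x; rewrite !finset.in_set; exact: leq_trans.
  by rewrite -natrB ?subset_leq_card // /scale cardsD (finset.setIidPr sub).
by rewrite cs; move: hk V1 V1m st Vm; lra.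
Qed.

(** Bounding [m1] keeps the sums over starting times finite; the estimates obtained are uniform in
    [M]. *)
Let jumpsM M := [set w | exists2 m1, (m1 < M)%N & jumps m1 w].

Let measurable_jumps m1 : measurable (jumps m1).
Proof.
rewrite (_ : jumps m1 = \bigcup_m2 ([set w | (L1 (G m1 w))%:R <= a * N] `&`
   [set w | (b * N <= (L1 (G m2 w))%:R) && (m2%:R <= m1%:R + h)])).
  apply: bigcupT_measurable => m2; apply: measurableI.
    exact: (measurable_graph_pred m1 (fun g => (L1 g)%:R <= a * N)).
  exact: (measurable_graph_pred m2
    (fun g => (b * N <= (L1 g)%:R) && (m2%:R <= m1%:R + h))).
apply/seteqP; split => w /=.
  by move=> [m2 [L1 L2 L3]]; exists m2 => //; split => //=; rewrite L2 L3.
by move=> [m2 _ [/= L1 /andP[L2 L3]]]; exists m2.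
Qed.

(** Counts the pairs of a scale [j < J] and a vertex surviving at that scale. Each scale contributes
    at least [kappa * N] times the probability of being active, while outside [bad] a vertex
    survives at no more than one scale. *)
Lemma pr_jumps_before M :
  J%:R * kappa * pr (jumpsM M) <=
  1 + J%:R * (1 + kappa) * (J%:R * 2^-1 ^+ (n.+1 %/ B ^ J)).
Proof.
pose act j := [set w | exists2 m, (m < M)%N & active j m w].
pose surv j x := [set w | exists2 m, (m < M)%N & survive j x m w].
pose stk j := [set w | exists2 m, (m < M)%N & stuck j m w].
pose bad := [set w | exists2 j, (j < J)%N & stk j w].
have [mjump _] := pr_union P (fun m1 (_ : (m1 < M)%N) => measurable_jumps m1).
have dact j m m' w : active j m w -> active j m' w -> m = m'.
  by move=> [f _] [f' _]; exact: first_inj f f'.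
(* The events [first j m] are disjoint in [m], so the union over starting times costs no factor
   [M]. *)
have prstk j : measurable (stk j) /\ pr (stk j) <= 2^-1 ^+ (n.+1 %/ B ^ j.+1).
  have [m1 e1] := @pr_disj _ _ _ P M (stuck j) (fun m _ => measurable_stuck j m)
    (fun m m' w _ _ f f' => first_inj f.1 f'.1).
  have [m2 e2] := @pr_disj _ _ _ P M (first j)
    (fun m _ => filtration_measurable (filtration_first j m))
    (fun m m' w _ _ f f' => first_inj f f').
  split => //; rewrite e1.
  apply: (@le_trans _ _ (2^-1 ^+ (n.+1 %/ B ^ j.+1) * \sum_(m < M) pr (first j m))).
    by rewrite mulr_sumr; apply: ler_sum => m _.
  by rewrite -e2 ler_piMr ?exprn_ge0 ?invr_ge0 // pr_le1.
have [mbad prbad] := pr_union P (fun j (_ : (j < J)%N) => (prstk j).1).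
have {}prbad : pr bad <= J%:R * 2^-1 ^+ (n.+1 %/ B ^ J).
  apply: le_trans prbad _; rewrite -[J in leRHS]card_ord mulr_natl -sumr_const.
  apply: ler_sum => j _; apply: le_trans (prstk j).2 _.
  rewrite ler_wiXn2l ?invr_ge0 ?invf_le1 ?ler1n //.
  by apply: leq_div2l; [exact: B_gt0|rewrite card_ord leB].
have [] : (forall j, measurable (act j)) /\ (forall j x, measurable (surv j x)).
  split=> [j|j x].
    by have [] := pr_union P (fun m (_ : (m < M)%N) =>
      filtration_measurable (filtration_active j m)).
  by have [] := pr_union P (fun m (_ : (m < M)%N) => measurable_survive j x m).
move=> mact msurv.
have lower j : (j < J)%N -> kappa * N * pr (act j) <= \sum_x pr (surv j x).
  move=> jJ.
  have [_ ->] := @pr_disj _ _ _ P M (active j)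
    (fun m _ => filtration_measurable (filtration_active j m))
    (fun m m' w _ _ => @dact j m m' w).
  under [leRHS]eq_bigr => x _.
    have [_ ->] := @pr_disj _ _ _ P M (survive j x) (fun m _ => measurable_survive j x m)
      (fun m m' w _ _ f f' => @dact j m m' w f.1.1 f'.1.1).
    over.
  rewrite exchange_big mulr_sumr; apply: ler_sum => m _; exact: pr_survive.
(* Outside [bad], [survive_inj] makes the events of different scales disjoint; [bad] is charged once
   per scale. *)
have upper x : \sum_(j < J) pr (surv j x) <= 1 + J%:R * pr bad.
  have mD j : (j < J)%N -> measurable (surv j x `\` bad).
    by move=> _; exact: measurableD.
  have dD i j w : (i < J)%N -> (j < J)%N ->
      (surv i x `\` bad) w -> (surv j x `\` bad) w -> i = j.
    move=> iJ jJ [[m mM si] nb] [[m' mM' sj] _].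
    apply: (survive_inj si sj) => st; apply: nb.
      by exists i => //; exists m.
    by exists j => //; exists m'.
  have [mU eU] := pr_disj P mD dD.
  apply: (@le_trans _ _ (\sum_(j < J) (pr (surv j x `\` bad) + pr bad))).
    apply: ler_sum => j _; rewrite (pr_split P (msurv j x) mbad) addrC lerD2l.
    by apply: pr_le => //; exact: measurableI.
  rewrite big_split /= -eU sumr_const card_ord mulr_natl lerD2r; exact: pr_le1.
have jump_le j : (j < J)%N -> pr (jumpsM M) <= pr (act j) + pr bad.
  move=> jJ; rewrite (pr_split P mjump mbad) addrC; apply: lerD.
    apply: pr_le => //; first exact: measurableD.
    move=> w [[m1 m1M jw] nb].
    have [|m mm1 am] := jumps_active jJ jw.
      move=> m mm1 st; apply: nb; exists j => //; exists m => //.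
      exact: leq_ltn_trans m1M.
    by exists m => //; exact: leq_ltn_trans m1M.
  by apply: pr_le => //; exact: measurableI.
have N0 : 0 < N by [].
have : J%:R * (kappa * N * (pr (jumpsM M) - pr bad)) <= N * (1 + J%:R * pr bad).
  apply: (@le_trans _ _ (\sum_(j < J) \sum_x pr (surv j x))).
    rewrite -[J in leLHS]card_ord mulr_natl -sumr_const; apply: ler_sum => j _.
    apply: le_trans (lower _ (ltn_ord j)); apply: ler_wpM2l.
      by rewrite mulr_ge0.
    by rewrite lerBlDr jump_le.
  rewrite exchange_big /= -[n.+1 in leRHS]card_ord mulr_natl -sumr_const.
  by apply: ler_sum => x _; exact: upper.
rewrite (_ : J%:R * _ = N * (J%:R * kappa * (pr (jumpsM M) - pr bad))); last by ring.
rewrite ler_pM2l // => fin.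
have J0 : 0 <= J%:R * (1 + kappa) by rewrite mulr_ge0 // addr_ge0.
by have := ler_wpM2l J0 prbad; move: fin; lra.
Qed.

(** The bound for [jumpsM M] is independent of [M], so continuity from below carries it to the
    union. *)
Lemma pr_jumps :
  measurable [set w | exists m1 m2 : nat, [/\ (L1 (G m1 w))%:R <= a * N,
    b * N <= (L1 (G m2 w))%:R & m2%:R <= m1%:R + h]] /\
  J%:R * (expR (- (4 * (l * C)%:R)) * ((b - alpha) / 2)) *
  pr [set w | exists m1 m2 : nat, [/\ (L1 (G m1 w))%:R <= a * N,
    b * N <= (L1 (G m2 w))%:R & m2%:R <= m1%:R + h]] <=
  1 + J%:R * (1 + expR (- (4 * (l * C)%:R)) * ((b - alpha) / 2)) *
    (J%:R * 2^-1 ^+ (n.+1 %/ B ^ J)).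
Proof.
rewrite (_ : [set w | _] = \bigcup_M jumpsM M); last first.
  apply/seteqP; split => w /=.
    by move=> [m1 Hm]; exists m1.+1 => //; exists m1.
  by move=> [M _ [m1 _ Hm]]; exists m1.
have mM M : measurable (jumpsM M).
  by have [] := pr_union P (fun m1 (_ : (m1 < M)%N) => measurable_jumps m1).
have mU : measurable (\bigcup_M jumpsM M) by exact: bigcupT_measurable.
split => //.
have nd : nondecreasing_seq jumpsM.
  move=> M M' MM'; apply/subsetPset => w [m1 m1M Hm]; exists m1 => //.
  exact: leq_trans MM'.
have cv := nondecreasing_cvg_mu (mu := P) mM mU nd.
have {}cv : pr (jumpsM M) @[M --> \oo] --> pr (\bigcup_M jumpsM M).
  by apply: fine_cvg; rewrite -(prE P mU); exact: cv.
rewrite -/kappa.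
have cv2 : J%:R * kappa * pr (jumpsM M) @[M --> \oo] -->
    J%:R * kappa * pr (\bigcup_M jumpsM M) by apply: cvgMr.
rewrite -(cvg_lim _ cv2) //; apply: limr_le; first by apply/cvg_ex; eexists; exact: cv2.
by apply: nearW => M; exact: pr_jumps_before.
Qed.

End Process.

(** * Choice of the constants and passage to the limit *)

Lemma geometric_small (R : realType) (z D : R) : 0 <= z -> z < 1 -> 0 < D ->
  exists r0, forall r, (r0 <= r)%N -> z ^+ r <= D.
Proof.
move=> z0 z1 D0.
have : (fun r => z ^+ r) @ \oo --> (0 : R) by apply: cvg_expr; rewrite ger0_norm.
move/cvgr0Pnorm_le/(_ D D0) => [r0 _ H]; exists r0 => r rr.
by apply: le_trans (H r rr); exact: ler_norm.
Qed.

Lemma nat_above (R : realType) (x : R) : exists k, forall m, (k <= m)%N -> x <= m%:R.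
Proof.
have [k xk] : exists k : nat, x <= k%:R.
  by exists (Num.bound `|x|); apply: le_trans (ler_norm x) (ltW (archi_boundP _)).
by exists k => m km; apply: le_trans xk _; rewrite ler_nat.
Qed.

(* The process with n.+1 vertices is indexed by n (vertex set 'I_n.+1). *)
Theorem theorem4 (R : realType) (l : nat) (hl : (2 <= l)%N)
  (d : nat -> measure_display) (T : forall n : nat, measurableType (d n))
  (P : forall n : nat, probability (T n) R)
  (F : forall n : nat, nat -> set (set (T n)))
  (v : forall n : nat, nat -> T n -> {ffun 'I_l -> 'I_n.+1})
  (E G : forall n : nat, nat -> T n -> graph n.+1)
  (h : nat -> R) (a b : R) :
  (forall n, is_filtration (F n)) ->
  (forall n, uniform_indep_tuples (P n) (F n) (v n)) ->
  (forall n, ell_vertex_rule (F n) (v n) (E n) (G n)) ->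
  (forall n, merging (P n) (F n) l (G n)) ->
  (fun n : nat => h n / n%:R) @ \oo --> 0 ->
  0 <= a -> a < b ->
  (fun n : nat =>
     P n [set w | exists m1 m2 : nat,
            [/\ (L1 (G n m1 w))%:R <= a * n.+1%:R,
                b * n.+1%:R <= (L1 (G n m2 w))%:R
              & m2%:R <= m1%:R + h n.+1]]) @ \oo --> 0%E.
Proof.
move=> hF hv hG hm hh a0 ab.
have l0 : (0 < l)%N by exact: ltnW.
have l0R : 0 < l%:R :> R by rewrite ltr0n.
(* This choice gives [alpha <= (a + b) / 2 < b]. *)
pose delta : R := Num.min 1 ((b - a) / (4 * l%:R)).
have d0 : 0 < delta.
  by rewrite lt_min ltr01 divr_gt0 // ?mulr_gt0 // subr_gt0.
have d1 : delta <= 1 by rewrite ge_min lexx.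
pose alpha := a + (2 * l)%:R * delta.
have hb : alpha < b.
  have : delta <= (b - a) / (4 * l%:R) by rewrite ge_min lexx orbT.
  rewrite ler_pdivlMr ?mulr_gt0 // => H.
  by rewrite /alpha natrM; lra.
pose q := delta ^+ l.
have q1 : q <= 1 by apply: exprn_ile1 => //; exact: ltW.
have q0 : 0 < q by rewrite exprn_gt0.
have [C /(_ C (leqnn C)) hC] : exists C, forall r, (C <= r)%N -> (1 - q / 2) ^+ r <= 4^-1.
  by apply: geometric_small; rewrite ?invr_gt0 //; lra.
have [B0 HB0] := nat_above (4 * (l * C)%:R / (b - alpha)).
pose B := B0.+2.
have hB : 4 * (l * C)%:R <= (b - alpha) * B%:R.
  by rewrite [leRHS]mulrC -ler_pdivrMr ?subr_gt0 // HB0 // ltnW // ltnW.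
pose kappa : R := expR (- (4 * (l * C)%:R)) * ((b - alpha) / 2).
have k0 : 0 < kappa by rewrite mulr_gt0 ?expR_gt0 // divr_gt0 // subr_gt0.
pose Q n := [set w : T n | exists m1 m2 : nat,
            [/\ (L1 (G n m1 w))%:R <= a * n.+1%:R,
                b * n.+1%:R <= (L1 (G n m2 w))%:R
              & m2%:R <= m1%:R + h n.+1]].
(* Measurability is carried along to make [P n (Q n)] finite, so that convergence can be checked on
   its real value. *)
suff key : forall e : R, 0 < e -> \forall n \near \oo,
    measurable (Q n) /\ pr (P n) (Q n) <= e.
  apply/fine_cvgP; split.
    have := key 1 ltr01; apply: filterS => n [mQ _].
    by rewrite fin_num_measure.
  apply/cvgr0Pnorm_le => e e0; have := key e e0; apply: filterS => n [mQ le].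
  by rewrite ger0_norm //; exact: pr_ge0.
move=> e e0.
(* The right-hand side of [pr_jumps] will be at most 2, so [J * kappa * e >= 2] suffices. *)
have [J /(_ J.+1 (leqnSn J)) HJ] := nat_above (2 / (kappa * e)).
have {}HJ : 2 <= J.+1%:R * kappa * e.
  by rewrite -mulrA -ler_pdivrMr; [exact: HJ|exact: mulr_gt0].
move: J.+1 (ltn0Sn J) HJ => {}J J0 HJ.
pose K := (B ^ J)%N.
have K0 : (0 < K)%N by rewrite expn_gt0.
have JR : 0 < J%:R :> R by rewrite ltr0n.
pose D : R := J%:R * (1 + kappa) * J%:R.
have D0 : 0 < D by rewrite !mulr_gt0 // addr_gt0.
have [r0 Hr0] : exists r0, forall r, (r0 <= r)%N -> (2^-1 : R) ^+ r <= D^-1.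
  by apply: geometric_small; rewrite ?invr_ge0 ?invf_lt1 ?ltr1n ?invr_gt0.
have Kl0 : 0 < (K * l)%:R :> R by rewrite ltr0n muln_gt0 K0.
(* [h n.+1] and [1 + C] will each be at most [eta * n.+1], and [K * l * (2 * eta)] equals
   [(b - alpha) / 4]. *)
pose eta : R := (b - alpha) / (8 * (K * l)%:R).
have eta0 : 0 < eta by rewrite divr_gt0 ?mulr_gt0 // subr_gt0.
move/cvgr0Pnorm_le: hh => /(_ eta eta0)[N1 _ HN1].
have [N2 HN2] := nat_above ((1 + C%:R) / eta).
exists (maxn (maxn N1 N2) (maxn (2 * K) (r0 * K))) => // n /=.
rewrite !geq_max => /andP[/andP[n1 n2] /andP[n3 n4]].
have hn : h n.+1 <= eta * n.+1%:R.
  have := HN1 n.+1 (leqW n1); rewrite /= normrM normfV.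
  rewrite [X in _ / X]ger0_norm // ler_pdivrMr // => H.
  by apply: le_trans H; exact: ler_norm.
have Cn : 1 + C%:R <= eta * n.+1%:R.
  by rewrite [leRHS]mulrC -ler_pdivrMr // HN2 //; exact: leqW.
have etaE : (K * l)%:R * eta = (b - alpha) / 8.
  by rewrite /eta; field; rewrite ?pnatr_eq0 ?muln_eq0 -?lt0n ?K0 ?l0.
have hhn : (K * l)%:R * (h n.+1 + 1 + C%:R) <= (b - alpha) / 4 * n.+1%:R.
  apply: (@le_trans _ _ ((K * l)%:R * (2 * (eta * n.+1%:R)))).
    by apply: ler_wpM2l; [exact: ltW|lra].
  have -> : (K * l)%:R * (2 * (eta * n.+1%:R)) = 2 * ((K * l)%:R * eta) * n.+1%:R :> R.
    by ring.
  by rewrite etaE; lra.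
have [mQ le] := @pr_jumps R (d n) (T n) (P n) (F n) l n (v n) (E n) (G n) (hF n) (hv n)
  (hG n) (hm n) a delta l0 a0 d0 d1 C hC b (h n.+1) B J hb (isT : (1 < B)%N) hB
  (leqW n3) hhn.
split => //.
have small : D * 2^-1 ^+ (n.+1 %/ K) <= 1.
  rewrite -ler_pdivlMl // mulr1; apply: Hr0.
  by rewrite leq_divRL //; exact: leqW.
have Jk : 0 < J%:R * kappa by rewrite mulr_gt0.
rewrite -(ler_pM2l Jk).
apply: le_trans (le_trans le _) HJ; rewrite -/kappa mulrA -/D; lra.
Qed.
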